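(* Let $A$, $\overline{A}=A/tA$, $\widehat{A}$ and $\widehat{\Gamma}:\widehat{A}\to\overline{A}$ be as described in the context. For $\sigma\in\mathrm{End}(\widehat{A})$ let $\varphi(\sigma):\overline{A}\to\overline{A}$ be the map defined by $\varphi(\sigma)(z)=\widehat{\Gamma}(\sigma(z'))$, where $z'\in\widehat{A}$ and $\widehat{\Gamma}(z')=z$. Then the map $$\varphi:\mathrm{End}(\widehat{A})\to\mathrm{P.End}(\overline{A}),\qquad \sigma\mapsto\varphi(\sigma)$$ is a semigroup homomorphism such that its restriction $$\varphi|_{\mathrm{Aut}(\widehat{A})}:\mathrm{Aut}(\widehat{A})\to\mathrm{P.Aut}(\overline{A})$$ is a group homomorphism.
   Context: $\mathbf{k}$ is an algebraically closed field of characteristic zero, $\mathbf{k}^*=\mathbf{k}\setminus\{0\}$, $t$ is an indeterminate. All algebras are associative and unital. Setting. $A$ is a $\mathbf{k}[t]$-algebra generated by $x_1,\ldots,x_n$ subject to relations $f_1,\ldots,f_r$, where $f_i=\sum_{\mathbf{x}}a^i_{\mathbf{x}}(t)\mathbf{x}$ with $a^i_{\mathbf{x}}(t)\in\mathbf{k}[t]$ and $\mathbf{x}$ running over monomials (finite products of the $x_j$). Assume: (i) $t$ is a regular element of $A$: a nonzero, nonunit, non-zero-divisor, central element such that $A/tA$ is commutative. Then $\overline{A}:=A/tA$ is a Poisson algebra with bracket $\{\overline{a},\overline{b}\}=\overline{t^{-1}(ab-ba)}$. (ii) For each $q\in\mathbf{k}^*$, $A_q:=A/(t-q)A$ is nonzero.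 (So $\overline{A}$ and $A_q$ are the $\mathbf{k}$-algebras generated by $x_1,\dots,x_n$ with relations $f_i|_{t=0}$, respectively $f_i|_{t=q}$.) (iii) $A$ has a $\mathbf{k}[t]$-basis $\{\xi_i\mid i\in I\}$ such that, for each $q\in\mathbf{k}^*$, the families $\{\xi_i+tA\}_{i\in I}$ and $\{\xi_i+(t-q)A\}_{i\in I}$ are $\mathbf{k}$-bases of $\overline{A}$ and $A_q$ respectively; these images are again written $\xi_i$. For $f(t)=\sum_i a_i(t)\xi_i\in A$ write $f(0)=\overline{f(t)}=\sum_i a_i(0)\xi_i\in\overline{A}$ and $f(q)=\sum_i a_i(q)\xi_i\in A_q$. The algebra $\widehat{A}$. Let $\widehat{q}$ be the parameter taking values in $\mathbf{k}^*$, i.e. the function $\mathbf{k}^*\to\mathbf{k}$, $\widehat{q}(q)=q$. $A_{\widehat{q}}$ is the $\mathbf{k}$-algebra obtained from $A_q$ by replacing $q$ by $\widehat{q}$; it contains $\widehat{q}^{-1}$ (that is, it is generated over $\mathbf{k}[\widehat{q},\widehat{q}^{-1}]$ by $x_1,\ldots,x_n$ with relations $f_i|_{t=\widehat{q}}$). For $f(t)=\sum_i a_i(t)\xi_i\in A$ put $f(\widehat{q})=\sum_i a_i(\widehat{q})\xi_i\in A_{\widehat{q}}$. Let $\gamma:A\to\prod_{q\in\mathbf{k}^*}A_q$, $f(t)\mapsto(f(q))_{q}$, which is an injective $\mathbf{k}$-algebra homomorphism, let $\widehat{\ }:A_{\widehat{q}}\to\prod_{q\in\mathbf{k}^*}A_q$,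 $f\mapsto(f|_{\widehat{q}=q})_q$, and let $\widehat{A}$ be the preimage of $\gamma(A)$ under $\widehat{\ }$; it is a $\mathbf{k}$-subalgebra of $A_{\widehat{q}}$. Let $\widehat{\Gamma}:\widehat{A}\to\overline{A}$ be the composition of $\widehat{\ }:\widehat{A}\to\gamma(A)$, $\gamma^{-1}:\gamma(A)\to A$ and the projection $A\to\overline{A}$; that is, $\widehat{\Gamma}(f(\widehat{q}))=f(0)$. It is a surjective $\mathbf{k}$-algebra homomorphism. Endomorphisms. $\mathrm{End}(\widehat{A})$ and $\mathrm{Aut}(\widehat{A})$ denote the sets of all endomorphisms and all automorphisms of the $\mathbf{k}$-algebra $\widehat{A}$. $\mathrm{P.End}(\overline{A})$ and $\mathrm{P.Aut}(\overline{A})$ denote the sets of all Poisson endomorphisms (algebra endomorphisms $f$ with $f(\{a,b\})=\{f(a),f(b)\}$ for all $a,b$) and all Poisson automorphisms of $\overline{A}$. Under composition, $\mathrm{End}(\widehat{A})$ and $\mathrm{P.End}(\overline{A})$ are semigroups, and $\mathrm{Aut}(\widehat{A})$ and $\mathrm{P.Aut}(\overline{A})$ are groups.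
   Formalization: Endomorphisms and automorphisms of Â are required to fix the parameter q̂; for all k-algebra endomorphisms the claim fails: with A = k[t], Â = k[q̂], the automorphism q̂ ↦ q̂+1 makes φ(σ) ill-defined. *)

(* Defs.v *)
From HB Require Import structures.
From mathcomp Require Import finmap monalg.
From mathcomp Require Import all_boot all_algebra.
From mathcomp Require Import boolp classical_sets functions.

Set Implicit Arguments.
Unset Strict Implicit.
Unset Printing Implicit Defensive.

Import GRing.Theory.
Local Open Scope ring_scope.
Local Open Scope classical_set_scope.

Section RingQuotient.
Variables (R : pzRingType) (S : set R).

Definition two_sided_ideal (J : set R) : Prop :=
  [/\ J 0, forall x y, J x -> J y -> J (x - y)
    & forall a x b, J x -> J (a * x * b)].

Definition ideal_gen : set R :=
  [set x | forall J, two_sided_ideal J -> S `<=` J -> J x].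

Lemma ideal_gen_ideal : two_sided_ideal ideal_gen.
Proof.
split=> [J [] //|x y Ix Iy J Jid SJ|a x b Ix J Jid SJ].
  by case: (Jid) => _ JB _; apply: JB; [apply: Ix | apply: Iy].
by case: (Jid) => _ _ JM; apply: JM; apply: Ix.
Qed.

Lemma sub_ideal_gen : S `<=` ideal_gen.
Proof. by move=> x Sx J _ SJ; exact: SJ. Qed.

Definition ideal_pred : {pred R} := [pred x | `[< ideal_gen x >]].

Lemma ideal_pred_zmod_closed : zmod_closed ideal_pred.
Proof.
have [I0 IB _] := ideal_gen_ideal.
by split=> [|x y /asboolP Ix /asboolP Iy]; apply/asboolP => //; apply: IB.
Qed.

HB.instance Definition _ :=
  GRing.isZmodClosed.Build R ideal_pred ideal_pred_zmod_closed.

(* MathComp only provides the ring structure of a quotient for commutative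
   rings; here [ring_quot] is the quotient of R by the two-sided ideal generated
   by S, which may be the zero ring. *)
Definition ring_quot : Type := @Quotient.quot R ideal_pred.

HB.instance Definition _ := GRing.Zmodule.on ring_quot.
End RingQuotient.

HB.lock Definition proj (R : pzRingType) (S : set R) (x : R) : ring_quot S :=
  (\pi_(@Quotient.quot R (ideal_pred S)) x)%qT.

Section RingQuotientTheory.
Variables (R : pzRingType) (S : set R).
Local Notation ring_quot := (ring_quot S).
Local Notation ideal_pred := (ideal_pred S).
Local Notation ideal_gen := (ideal_gen S).
Local Notation proj := (@proj R S).

Lemma projP x y : proj x = proj y <-> ideal_gen (x - y).
Proof.
have e : ((proj x == proj y) = (x - y \in ideal_pred)).
  by rewrite proj.unlock (Quotient.idealrBE ideal_pred).
by split=> [/eqP|h]; [rewrite e => /asboolP | apply/eqP; rewrite e; apply/asboolP].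
Qed.

Lemma proj_surj (u : ring_quot) : exists x, proj x = u.
Proof. by exists (@repr R (@Quotient.quot R ideal_pred) u); rewrite proj.unlock reprK. Qed.

Definition qrepr (u : ring_quot) : R := projT1 (cid (proj_surj u)).

Lemma qreprK : cancel qrepr proj.
Proof. by move=> u; rewrite /qrepr; case: cid. Qed.

Fact proj_is_zmod_morphism : zmod_morphism proj.
Proof. by move=> x y; rewrite proj.unlock; apply: (raddfB (\pi_(@Quotient.quot R ideal_pred))%qT). Qed.

HB.instance Definition _ :=
  GRing.isZmodMorphism.Build R ring_quot proj proj_is_zmod_morphism.

End RingQuotientTheory.

HB.lock Definition qmul (R : pzRingType) (S : set R) (u v : ring_quot S) :
  ring_quot S := proj S (qrepr u * qrepr v).

Section RingQuotientRing.
Variables (R : pzRingType) (S : set R).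
Local Notation ring_quot := (ring_quot S).
Local Notation proj := (@proj R S).
Local Notation qmul := (@qmul R S).
Local Notation ideal_gen := (ideal_gen S).
Local Notation projP := (@projP R S).
Local Notation qrepr := (@qrepr R S).
Local Notation qreprK := (@qreprK R S).

Fact proj_mul x y : proj (x * y) = qmul (proj x) (proj y).
Proof.
rewrite qmul.unlock; apply/projP; have [_ IB IM] := ideal_gen_ideal S.
have Ix : ideal_gen (x - qrepr (proj x)) by apply/projP; rewrite qreprK.
have Iy : ideal_gen (qrepr (proj y) - y) by apply/projP; rewrite qreprK.
have -> : x * y - qrepr (proj x) * qrepr (proj y) =
    1 * (x - qrepr (proj x)) * y - qrepr (proj x) * (qrepr (proj y) - y) * 1.
  by rewrite mul1r mulr1 mulrBl mulrBr opprB addrA subrK.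
by apply: IB; apply: IM.
Qed.

Fact qmulA : associative qmul.
Proof.
move=> u v w; rewrite -(qreprK u) -(qreprK v) -(qreprK w).
by rewrite -!proj_mul mulrA.
Qed.
Fact qmul1 : left_id (proj 1) qmul.
Proof. by move=> u; rewrite -(qreprK u) -proj_mul mul1r. Qed.
Fact qmulr1 : right_id (proj 1) qmul.
Proof. by move=> u; rewrite -(qreprK u) -proj_mul mulr1. Qed.
Fact qmulDl : left_distributive qmul +%R.
Proof.
move=> u v w; rewrite -(qreprK u) -(qreprK v) -(qreprK w).
by rewrite -raddfD -!proj_mul mulrDl raddfD.
Qed.
Fact qmulDr : right_distributive qmul +%R.
Proof.
move=> u v w; rewrite -(qreprK u) -(qreprK v) -(qreprK w).
by rewrite -raddfD -!proj_mul mulrDr raddfD.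
Qed.

HB.instance Definition _ := GRing.Zmodule_isPzRing.Build ring_quot
  qmulA qmul1 qmulr1 qmulDl qmulDr.

Fact proj_is_monoid_morphism : GRing.monoid_morphism proj.
Proof. by split=> // x y; apply: proj_mul. Qed.

HB.instance Definition _ :=
  GRing.isMonoidMorphism.Build R ring_quot proj proj_is_monoid_morphism.

Section Lift.
Variables (B : pzRingType) (h : {rmorphism R -> B}).
Hypothesis hS : forall s, S s -> h s = 0.

Definition quot_lift of (forall s, S s -> h s = 0) :=
  fun u : ring_quot => h (qrepr u).

Lemma quot_liftE x : quot_lift hS (proj x) = h x.
Proof.
apply/eqP; rewrite -subr_eq0 -rmorphB /=; apply/eqP.
have /(_ [set x | h x = 0]) : ideal_gen (qrepr (proj x) - x).
  by apply/projP; rewrite qreprK.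
apply=> //; split=> /= [|a b ha hb|a b c hb]; first exact: rmorph0.
  by rewrite rmorphB ha hb subrr.
by rewrite !rmorphM hb mulr0 mul0r.
Qed.

Fact quot_lift_zmod : zmod_morphism (quot_lift hS).
Proof.
move=> u v; rewrite -(qreprK u) -(qreprK v) -rmorphB.
by rewrite !quot_liftE rmorphB.
Qed.

Fact quot_lift_monoid : GRing.monoid_morphism (quot_lift hS).
Proof.
split; first by rewrite -(rmorph1 proj) quot_liftE rmorph1.
move=> u v; rewrite -(qreprK u) -(qreprK v) -rmorphM.
by rewrite !quot_liftE rmorphM.
Qed.

HB.instance Definition _ := GRing.isZmodMorphism.Build
  ring_quot B (quot_lift hS) quot_lift_zmod.
HB.instance Definition _ := GRing.isMonoidMorphism.Build
  ring_quot B (quot_lift hS) quot_lift_monoid.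
End Lift.

End RingQuotientRing.

HB.lock Definition coef_map (M : monomType) (R1 R2 : comNzRingType)
    (phi : {rmorphism R1 -> R2}) (g : {malg R1[M]}) : {malg R2[M]} :=
  \sum_(m <- msupp g) << phi g@_m *g m >>.

Section CoefMap.
Variables (M : monomType) (R1 R2 : comNzRingType) (phi : {rmorphism R1 -> R2}).
Local Notation coef_map := (@coef_map M R1 R2 phi).

Lemma malgUM (c1 c2 : R2) (m1 m2 : M) :
  (<< c1 *g m1 >> : {malg R2[M]}) * << c2 *g m2 >> = << c1 * c2 *g mmul m1 m2 >>.
Proof. by rewrite malgM_def fgmulUU. Qed.

Definition monom (m : M) : {malg R2[M]} := << m >>.

Fact monom_morph : mmorphism monom.
Proof. by split=> // x y; rewrite /monom malgUM mulr1. Qed.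

HB.instance Definition _ :=
  monalg.isMultiplicative.Build M {malg R2[M]} monom monom_morph.

Definition coefC : R1 -> {malg R2[M]} := @malgC M R2 \o phi.
HB.instance Definition _ := GRing.RMorphism.on coefC.

Lemma coef_mapE : coef_map = mmap coefC monom.
Proof.
apply/funext=> g; rewrite coef_map.unlock /mmap; apply: eq_bigr => m _ /=.
by rewrite malgUM mul1m mulr1.
Qed.

Lemma coef_mapU (c : R1) (m : M) : coef_map << c *g m >> = << phi c *g m >>.
Proof. by rewrite coef_mapE mmapU /coefC /monom /= malgUM mul1m mulr1. Qed.

Fact coef_map_zmod : zmod_morphism coef_map.
Proof. by rewrite coef_mapE; exact: raddfB. Qed.

Fact coef_map_monoid : GRing.monoid_morphism coef_map.
Proof.
rewrite coef_mapE.
have [|hm h1] := @commr_mmap_is_multiplicative M R1 {malg R2[M]} coefC monom.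
  move=> g m m'; rewrite /GRing.comm /= /monom /coefC /= !malgUM mulr1 mul1r.
  by rewrite mul1m mulm1.
by split.
Qed.

HB.instance Definition _ := GRing.isZmodMorphism.Build
  {malg R1[M]} {malg R2[M]} coef_map coef_map_zmod.
HB.instance Definition _ := GRing.isMonoidMorphism.Build
  {malg R1[M]} {malg R2[M]} coef_map coef_map_monoid.
End CoefMap.

(* The scalars in the quotient of a free algebra over R *)
HB.lock Definition free_scalar (R : comNzRingType) (n : nat)
    (S : set {malg R[{fmonom 'I_n}]}) (c : R) : ring_quot S := proj S c%:MP.

Section FreeScalar.
Variables (R : comNzRingType) (n : nat) (S : set {malg R[{fmonom 'I_n}]}).
Fact free_scalar_zmod : zmod_morphism (@free_scalar R n S).
Proof. by move=> a b; rewrite free_scalar.unlock !raddfB. Qed.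
Fact free_scalar_monoid : GRing.monoid_morphism (@free_scalar R n S).
Proof.
rewrite free_scalar.unlock; split=> [|a b]; first exact: rmorph1.
by rewrite mpolyCM; exact: rmorphM.
Qed.
HB.instance Definition _ := GRing.isZmodMorphism.Build
  R (ring_quot S) (@free_scalar R n S) free_scalar_zmod.
HB.instance Definition _ := GRing.isMonoidMorphism.Build
  R (ring_quot S) (@free_scalar R n S) free_scalar_monoid.
End FreeScalar.

Section Laurent.
Variable k : closedFieldType.

Definition kstar : Type := {q : k | q != 0}.
HB.instance Definition _ := Choice.on kstar.
HB.instance Definition _ :=
  isPointed.Build kstar (exist _ (1 : k) (oner_neq0 k)).

Definition laurent_pred : {pred (kstar -> k)} :=
  [pred g | `[< exists (p : {poly k}) (m : nat),
                  forall q : kstar, g q = p.[sval q] / sval q ^+ m >]].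

Fact laurent_subring_closed : GRing.subring_closed laurent_pred.
Proof.
have nz (q : kstar) m : sval q ^+ m != 0 by rewrite expf_neq0 // (svalP q).
split=> [|x y /asboolP[p [m hp]] /asboolP[r [l hr]]
         |x y /asboolP[p [m hp]] /asboolP[r [l hr]]]; apply/asboolP.
- by exists 1, 0%N => q; rewrite hornerC expr0 divr1.
- exists (p * 'X^l - r * 'X^m), (m + l)%N => q.
  rewrite /GRing.add /GRing.opp /= hp hr !hornerE exprD.
  by rewrite -mulNr addf_div // mulNr.
- exists (p * r), (m + l)%N => q.
  by rewrite /GRing.mul /= hp hr hornerM exprD mulf_div.
Qed.
HB.instance Definition _ :=
  GRing.isSubringClosed.Build (kstar -> k) laurent_pred laurent_subring_closed.

(* k[qhat, qhat^-1], as a ring of functions of the parameter in k^*. *)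
Record laurent := Laurent {
  laurent_fun :> kstar -> k;
  laurentP : laurent_fun \in laurent_pred }.
HB.instance Definition _ := [isSub for laurent_fun].
HB.instance Definition _ := [Choice of laurent by <:].
HB.instance Definition _ := [SubChoice_isSubComNzRing of laurent by <:].

Fact poly_qhat_subproof (p : {poly k}) :
  (fun q : kstar => p.[sval q]) \in laurent_pred.
Proof. by apply/asboolP; exists p, 0%N => q; rewrite expr0 divr1. Qed.

(* p(t) |-> p(qhat) *)
Definition poly_qhat (p : {poly k}) : laurent := Laurent (poly_qhat_subproof p).

Fact poly_qhat_zmod : zmod_morphism poly_qhat.
Proof. by move=> p r; apply/val_inj/funext => q /=; rewrite hornerD hornerN. Qed.
Fact poly_qhat_monoid : GRing.monoid_morphism poly_qhat.
Proof.
by split=> [|p r]; apply/val_inj/funext => q /=; rewrite ?hornerC ?hornerM.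
Qed.
HB.instance Definition _ :=
  GRing.isZmodMorphism.Build {poly k} laurent poly_qhat poly_qhat_zmod.
HB.instance Definition _ :=
  GRing.isMonoidMorphism.Build {poly k} laurent poly_qhat poly_qhat_monoid.

(* g |-> the constant polynomial g(q) *)
Definition laurent_at (q : kstar) (g : laurent) : {poly k} := (g q)%:P.

Fact laurent_at_zmod q : zmod_morphism (laurent_at q).
Proof. by move=> g h; rewrite /laurent_at /= -polyCB. Qed.
Fact laurent_at_monoid q : GRing.monoid_morphism (laurent_at q).
Proof. by split=> [|g h]; rewrite /laurent_at /= -?polyCM. Qed.
HB.instance Definition _ q := GRing.isZmodMorphism.Build
  laurent {poly k} (laurent_at q) (laurent_at_zmod q).
HB.instance Definition _ q := GRing.isMonoidMorphism.Build
  laurent {poly k} (laurent_at q) (laurent_at_monoid q).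
End Laurent.

Section ScalarAction.
Variables (K B : pzRingType) (s : {rmorphism K -> B}).
Definition sact (c : K) (b : B) : B := s c * b.
Fact sactA a b v : sact a (sact b v) = sact (a * b) v.
Proof. by rewrite /sact rmorphM mulrA. Qed.
Fact sact1 : left_id 1 sact.
Proof. by move=> v; rewrite /sact rmorph1 mul1r. Qed.
Fact sactDr : right_distributive sact +%R.
Proof. by move=> c u v; rewrite /sact mulrDr. Qed.
Fact sactDl v : {morph sact^~ v : a b / a + b}.
Proof. by move=> a b; rewrite /sact rmorphD mulrDl. Qed.
End ScalarAction.

Section Algebras.
Variables (k : closedFieldType) (n r : nat).
Variable f : 'I_r -> {malg {poly k}[{fmonom 'I_n}]}.

(* The k[t]-algebra A; [{malg S[{fmonom 'I_n}]}] is the free S-algebra on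
   x_1, ..., x_n. *)
Definition qA : Type := ring_quot (range f).
HB.instance Definition _ := GRing.PzRing.on qA.

Definition free_proj : {malg {poly k}[{fmonom 'I_n}]} -> qA := @proj _ (range f).
HB.instance Definition _ := GRing.RMorphism.on free_proj.

Definition qA_scalar : {poly k} -> qA :=
  @free_scalar {poly k} n (range f).
HB.instance Definition _ := GRing.RMorphism.on qA_scalar.
HB.instance Definition _ := GRing.Zmodule_isLmodule.Build {poly k} qA
  (sactA qA_scalar) (sact1 qA_scalar) (sactDr qA_scalar) (sactDl qA_scalar).

Definition qA_t : qA := qA_scalar 'X.

(* A_q = A / (t - q)A; as t is central in A, (t - q)A is the two-sided ideal
   generated by t - q.  The case q = 0 is the semiclassical limit A / tA. *)
Definition qAat (q : k) : Type := ring_quot [set qA_t - qA_scalar q%:P].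
HB.instance Definition _ q := GRing.PzRing.on (qAat q).

Definition spec (q : k) : qA -> qAat q := @proj qA [set qA_t - qA_scalar q%:P].
HB.instance Definition _ q := GRing.RMorphism.on (spec q).

Definition qAat_scalar (q : k) : k -> qAat q := spec q \o qA_scalar \o polyC.
HB.instance Definition _ q := GRing.RMorphism.on (qAat_scalar q).
HB.instance Definition _ q := GRing.Zmodule_isLmodule.Build k (qAat q)
  (sactA (qAat_scalar q)) (sact1 (qAat_scalar q))
  (sactDr (qAat_scalar q)) (sactDl (qAat_scalar q)).

Definition Abar : Type := qAat 0.
HB.instance Definition _ := GRing.PzRing.on Abar.
HB.instance Definition _ := GRing.Lmodule.on Abar.

Definition bar : qA -> Abar := spec 0.
HB.instance Definition _ := GRing.RMorphism.on bar.

(* A_qhat, generated over k[qhat, qhat^-1] with relations f_i at t = qhat *)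
Definition qAhat_rel (i : 'I_r) : {malg (laurent k)[{fmonom 'I_n}]} :=
  coef_map (@poly_qhat k) (f i).

Definition qAhat : Type := ring_quot (range qAhat_rel).
HB.instance Definition _ := GRing.PzRing.on qAhat.

Definition qAhat_scalar : laurent k -> qAhat :=
  @free_scalar (laurent k) n (range qAhat_rel).
HB.instance Definition _ := GRing.RMorphism.on qAhat_scalar.

Definition qAhat_kscalar : k -> qAhat := qAhat_scalar \o @poly_qhat k \o polyC.
HB.instance Definition _ := GRing.RMorphism.on qAhat_kscalar.
HB.instance Definition _ := GRing.Zmodule_isLmodule.Build k qAhat
  (sactA qAhat_kscalar) (sact1 qAhat_kscalar)
  (sactDr qAhat_kscalar) (sactDl qAhat_kscalar).

(* Evaluation of the coefficients at qhat = q, from the free algebra over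
   k[qhat, qhat^-1] to A_q *)
Definition free_eval (q : kstar k) :
    {malg (laurent k)[{fmonom 'I_n}]} -> qAat (sval q) :=
  spec (sval q) \o free_proj \o coef_map (laurent_at q).
HB.instance Definition _ q := GRing.RMorphism.on (free_eval q).

Lemma specD q a b : spec q (a + b) = spec q a + spec q b.
Proof. exact: rmorphD. Qed.
Lemma specB q a b : spec q (a - b) = spec q a - spec q b.
Proof. exact: rmorphB. Qed.
Lemma specM q a b : spec q (a * b) = spec q a * spec q b.
Proof. exact: rmorphM. Qed.
Lemma spec0 q : spec q 0 = 0.
Proof. exact: rmorph0. Qed.
Lemma spec1 q : spec q 1 = 1.
Proof. exact: rmorph1. Qed.

Lemma qA_scalarD a b : qA_scalar (a + b) = qA_scalar a + qA_scalar b.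
Proof. exact: rmorphD. Qed.
Lemma qA_scalarB a b : qA_scalar (a - b) = qA_scalar a - qA_scalar b.
Proof. exact: rmorphB. Qed.
Lemma qA_scalarM a b : qA_scalar (a * b) = qA_scalar a * qA_scalar b.
Proof. exact: rmorphM. Qed.

Lemma spec_scalar (q : k) (p : {poly k}) :
  spec q (qA_scalar p) = spec q (qA_scalar p.[q]%:P).
Proof.
have /factor_theorem[u pE] : root (p - p.[q]%:P) q.
  by rewrite rootE !hornerE subrr.
have -> : p = u * ('X - q%:P) + p.[q]%:P by rewrite -pE subrK.
rewrite !hornerE subrr mulr0 add0r qA_scalarD qA_scalarM qA_scalarB specD specM.
have -> : spec q (qA_scalar 'X - qA_scalar q%:P) = 0.
  rewrite -(spec0 q); apply/projP; apply: sub_ideal_gen => /=.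
  exact: subr0.
by rewrite mulr0 add0r.
Qed.

Lemma free_eval_poly_qhat (q : kstar k) g :
  free_eval q (coef_map (@poly_qhat k) g) =
  spec (sval q) (free_proj g).
Proof.
rewrite (monalgE g).
apply: (big_ind (fun h => free_eval q (coef_map (@poly_qhat k) h) =
                          spec (sval q) (free_proj h))).
- have -> : free_proj 0 = 0 by exact: rmorph0.
  by rewrite spec0 (rmorph0 (coef_map _)); exact: rmorph0.
- move=> x y hx hy; rewrite (rmorphD (coef_map _)).
  have -> : free_proj (x + y) = free_proj x + free_proj y by exact: rmorphD.
  by rewrite specD -hx -hy; exact: rmorphD.
move=> m _; rewrite /free_eval /= !coef_mapU /laurent_at /=.
have U (c : {poly k}) : free_proj << c *g m >> = qA_scalar c * free_proj << m >>.
  have -> : << c *g m >> = c%:MP * << m >> :> {malg {poly k}[{fmonom 'I_n}]}.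
    by rewrite malgUM mul1m mulr1.
  by rewrite /qA_scalar free_scalar.unlock; exact: rmorphM.
have gen c c' : spec (sval q) (qA_scalar c) = spec (sval q) (qA_scalar c') ->
    spec (sval q) (free_proj << c *g m >>) = spec (sval q) (free_proj << c' *g m >>).
  move=> e; apply: etrans (congr1 _ (U c)) _.
  apply: etrans (specM _ _ _) _; apply: etrans _ (esym (congr1 _ (U c'))).
  apply: etrans _ (esym (specM _ _ _)); congr (_ * _); exact: e.
by apply: gen; symmetry; exact: spec_scalar.
Qed.

Fact free_eval_rel (q : kstar k) s : range qAhat_rel s -> free_eval q s = 0.
Proof.
case=> i _ <-; rewrite free_eval_poly_qhat.
have -> : free_proj (f i) = 0.
  rewrite -[RHS](rmorph0 free_proj); apply/projP.
  by rewrite subr0; apply: sub_ideal_gen; exists i.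
exact: spec0.
Qed.

Definition eval_at (q : kstar k) : qAhat -> qAat (sval q) :=
  quot_lift (@free_eval_rel q).
HB.instance Definition _ q := GRing.RMorphism.on (eval_at q).

Definition gamma (a : qA) : forall q : kstar k, qAat (sval q) :=
  fun q => spec (sval q) a.

Definition hat (z : qAhat) : forall q : kstar k, qAat (sval q) :=
  fun q => eval_at q z.

Definition Ahat_pred : {pred qAhat} := [pred z | `[< range gamma (hat z) >]].

Fact Ahat_subring_closed : GRing.subring_closed Ahat_pred.
Proof.
split=> [|x y /asboolP[a _ ha] /asboolP[b _ hb]
         |x y /asboolP[a _ ha] /asboolP[b _ hb]]; apply/asboolP.
- exists 1; first by [].
  by apply: functional_extensionality_dep => q;
    rewrite /gamma /hat (rmorph1 (spec (sval q))) (rmorph1 (eval_at q)).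
- exists (a - b); first by [].
  apply: functional_extensionality_dep => q.
  have ea : spec (sval q) a = eval_at q x := congr1 (@^~ q) ha.
  have eb : spec (sval q) b = eval_at q y := congr1 (@^~ q) hb.
  rewrite /gamma /hat.
  have -> : spec (sval q) (a - b) = spec (sval q) a - spec (sval q) b.
    exact: rmorphB.
  by rewrite ea eb; symmetry; exact: rmorphB.
- exists (a * b); first by [].
  apply: functional_extensionality_dep => q.
  have ea : spec (sval q) a = eval_at q x := congr1 (@^~ q) ha.
  have eb : spec (sval q) b = eval_at q y := congr1 (@^~ q) hb.
  rewrite /gamma /hat.
  have -> : spec (sval q) (a * b) = spec (sval q) a * spec (sval q) b.
    exact: rmorphM.
  by rewrite ea eb; symmetry; exact: rmorphM.
Qed.
HB.instance Definition _ :=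
  GRing.isSubringClosed.Build qAhat Ahat_pred Ahat_subring_closed.

Lemma eval_at_scalar (q : kstar k) (p : {poly k}) :
  eval_at q (qAhat_scalar (poly_qhat p)) = spec (sval q) (qA_scalar p).
Proof.
have -> : qAhat_scalar (poly_qhat p) =
    @proj _ (range qAhat_rel) (coef_map (@poly_qhat k) p%:MP).
  by rewrite coef_mapU /qAhat_scalar free_scalar.unlock.
rewrite /eval_at quot_liftE.
apply: etrans (free_eval_poly_qhat q p%:MP) _.
by rewrite /qA_scalar free_scalar.unlock.
Qed.

Fact poly_in_Ahat (p : {poly k}) : qAhat_scalar (poly_qhat p) \in Ahat_pred.
Proof.
apply/asboolP; exists (qA_scalar p); first by [].
by apply: functional_extensionality_dep => q; rewrite /gamma /hat eval_at_scalar.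
Qed.

Fact Ahat_scaler_closed : GRing.scaler_closed Ahat_pred.
Proof. by move=> c z Az; apply: rpredM => //; exact: poly_in_Ahat. Qed.
HB.instance Definition _ :=
  GRing.isScaleClosed.Build k qAhat Ahat_pred Ahat_scaler_closed.

Record Ahat := MkAhat { Ahat_val :> qAhat; AhatP : Ahat_val \in Ahat_pred }.
HB.instance Definition _ := [isSub for Ahat_val].
HB.instance Definition _ := [Choice of Ahat by <:].
HB.instance Definition _ := GRing.SubChoice_isSubPzRing.Build
  qAhat Ahat_pred Ahat Ahat_subring_closed.
HB.instance Definition _ := [SubZmodule_isSubLmodule of Ahat by <:].

Definition Ahat_q : Ahat := MkAhat (poly_in_Ahat 'X).

Definition gamma_inv (w : forall q : kstar k, qAat (sval q)) : qA :=
  xget 0 [set a | gamma a = w].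

Definition Gammahat (z : Ahat) : Abar := bar (gamma_inv (hat z)).

(* {bar a, bar b} = bar (t^-1 (ab - ba)) *)
Definition pbracket (u v : Abar) : Abar :=
  xget 0 [set w | exists a b c, [/\ bar a = u, bar b = v,
                                    qA_t * c = a * b - b * a & bar c = w]].

Record t_regular : Prop := TRegular {
  t_neq0 : qA_t <> 0;
  t_nonunit : ~ (exists a : qA, a * qA_t = 1 /\ qA_t * a = 1);
  t_nonzerodivisor : forall a : qA, qA_t * a = 0 \/ a * qA_t = 0 -> a = 0;
  t_central : forall a : qA, qA_t * a = a * qA_t;
  Abar_comm : forall u v : Abar, u * v = v * u }.

Lemma specP (q : k) (a b : qA) :
  t_regular -> spec q a = spec q b ->
  exists c, a - b = (qA_t - qA_scalar q%:P) * c.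
Proof.
move=> treg /projP; set u := qA_t - qA_scalar q%:P.
have uC c : u * c = c * u.
  rewrite mulrBl mulrBr (t_central treg); congr (_ - _).
  have [x <-] := proj_surj c.
  have e : q%:P%:MP * x = x * q%:P%:MP :> {malg {poly k}[{fmonom 'I_n}]}.
    rewrite [x]monalgE mulr_sumr mulr_suml; apply: eq_bigr => m _.
    by rewrite !malgUM mul1m mulm1 mulrC.
  have := congr1 free_proj e; rewrite /qA_scalar free_scalar.unlock.
  have M y z : free_proj (y * z) = free_proj y * free_proj z by exact: rmorphM.
  by move=> e'; exact: etrans (esym (M _ _)) (etrans e' (M _ _)).
move=> /(_ [set z | exists c, z = u * c]); apply=> [|_ ->]; last first.
  by exists 1; rewrite mulr1.
split=> /= [|x y [c ->] [d ->]|x y z [c ->]]; first by exists 0; rewrite mulr0.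
  by exists (c - d); rewrite mulrBr.
by exists (x * c * z); rewrite !mulrA uC.
Qed.

Lemma pbracketE (a b c : qA) :
  t_regular -> qA_t * c = a * b - b * a -> pbracket (bar a) (bar b) = bar c.
Proof.
move=> treg tc; rewrite /pbracket; case: xgetP => [w -> [a1 [b1 [c1]]]|]; last first.
  by move=> /(_ (bar c)); case; exists a, b, c.
have t0 d : (qA_t - qA_scalar 0%:P) * d = qA_t * d.
  have -> : qA_scalar 0%:P = 0 by rewrite polyC0; exact: rmorph0.
  by rewrite subr0.
move=> [/(specP treg)[x ax] /(specP treg)[y by_] tc1 <-].
rewrite !t0 in ax by_.
have {ax}a1E : a1 = a + qA_t * x by rewrite -ax addrC subrK.
have {by_}b1E : b1 = b + qA_t * y by rewrite -by_ addrC subrK.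
have tC := t_central treg.
have mulE u v p q : (u + qA_t * p) * (v + qA_t * q) =
    u * v + qA_t * (u * q + p * v + qA_t * (p * q)).
  have h1 : u * (qA_t * q) = qA_t * (u * q) by rewrite mulrA -tC mulrA.
  have h2 : qA_t * p * (qA_t * q) = qA_t * (qA_t * (p * q)).
    by rewrite -mulrA; congr (_ * _); rewrite mulrA -tC mulrA.
  by rewrite mulrDl !mulrDr h1 h2 -!mulrA !addrA.
pose d := (a * y + x * b + qA_t * (x * y)) - (b * x + y * a + qA_t * (y * x)).
have c1E : c1 = c + d.
  apply/eqP; rewrite -subr_eq0 opprD addrA; apply/eqP.
  apply: (t_nonzerodivisor treg); left.
  rewrite /d !mulrBr tc1 tc a1E b1E !mulE opprD addrACA.
  set X := a * b - b * a; set Y := qA_t * _ - qA_t * _.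
  by rewrite [X + Y]addrC addrK subrr.
have barM u v : bar (u * v) = bar (v * u).
  have M p q : bar (p * q) = bar p * bar q := specM 0 p q.
  by rewrite !M (Abar_comm treg).
have D p q : bar (p + q) = bar p + bar q := specD 0 p q.
have bart z : bar (qA_t * z) = 0.
  rewrite -[RHS](spec0 0); apply/projP; rewrite subr0.
  have [_ _ IM] := ideal_gen_ideal [set qA_t - qA_scalar 0%:P].
  rewrite -t0 -[_ * z]mul1r mulrA; apply: IM; apply: sub_ideal_gen.
  by apply: erefl.
rewrite c1E D; have -> : bar d = 0; last exact: addr0.
have -> : bar d = bar (a * y + x * b + qA_t * (x * y)) -
                  bar (b * x + y * a + qA_t * (y * x)) := specB 0 _ _.
by rewrite !D !bart (barM b x) (barM y a) !addr0 [bar (x * b) + _]addrC subrr.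
Qed.

End Algebras.

Section EndoMonoid.
Variable T : choiceType.

(* A class of maps T -> T containing the identity and closed under composition *)
Record endo_class := EndoClass {
  in_class :> (T -> T) -> Prop;
  class_id : in_class id;
  class_comp : forall s u, in_class s -> in_class u -> in_class (s \o u) }.

Variable E : endo_class.

Record endo := Endo { endo_fun :> T -> T; endoP : `[< E endo_fun >] }.
HB.instance Definition _ := [isSub for endo_fun].
HB.instance Definition _ := [Choice of endo by <:].

Definition endo_id : endo := Endo (introT (asboolP _) (class_id E)).
Definition endo_comp (s u : endo) : endo :=
  Endo (introT (asboolP _)
    (class_comp (elimT (asboolP _) (endoP s)) (elimT (asboolP _) (endoP u)))).

Fact endo_compA : associative endo_comp.
Proof. by move=> s u v; apply: val_inj. Qed.
Fact endo_comp1 : left_id endo_id endo_comp.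
Proof. by move=> s; apply: val_inj. Qed.
Fact endo_compr1 : right_id endo_id endo_comp.
Proof. by move=> s; apply: val_inj. Qed.
HB.instance Definition _ := isMonoid.Build endo endo_compA endo_comp1 endo_compr1.
End EndoMonoid.

Section MonoidUnits.
Variable M : monoidType.
Local Open Scope group_scope.

Definition invertible (x : M) : Prop := exists y, x * y = 1 /\ y * x = 1.

(* The group of invertible elements of M *)
Record munit := Munit { munit_val :> M; munitP : `[< invertible munit_val >] }.
HB.instance Definition _ := [isSub for munit_val].
HB.instance Definition _ := [Choice of munit by <:].

Fact munit_one_subproof : `[< invertible 1 >].
Proof. by apply/asboolP; exists 1; rewrite mulg1. Qed.
Fact munit_mul_subproof (x y : munit) :
  `[< invertible (munit_val x * munit_val y) >].
Proof.
case: x y => x /asboolP[x' [hx xh]] [y /asboolP[y' [hy yh]]] /=.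
apply/asboolP; exists (y' * x'); split.
  by rewrite mulgA -(mulgA x) hy mulg1.
by rewrite mulgA -(mulgA y') xh mulg1.
Qed.
Fact munit_inv_subproof (x : munit) :
  exists y : munit, munit_val x * munit_val y = 1 /\
                    munit_val y * munit_val x = 1.
Proof.
case: x => x /asboolP[y [hx xh]] /=.
by exists (@Munit y (introT (asboolP _) (ex_intro _ x (conj xh hx)))).
Qed.

Definition munit_one : munit := Munit munit_one_subproof.
Definition munit_mul (x y : munit) : munit := Munit (munit_mul_subproof x y).
Definition munit_inv (x : munit) : munit := projT1 (cid (munit_inv_subproof x)).

Fact munit_mulA : associative munit_mul.
Proof. by move=> x y z; apply: val_inj; rewrite /= mulgA. Qed.
Fact munit_mul1 : left_id munit_one munit_mul.
Proof. by move=> x; apply: val_inj; rewrite /= mul1g. Qed.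
Fact munit_mulr1 : right_id munit_one munit_mul.
Proof. by move=> x; apply: val_inj; rewrite /= mulg1. Qed.
Fact munit_mulV : left_inverse munit_one munit_inv munit_mul.
Proof. by move=> x; apply: val_inj; rewrite /munit_inv /=; case: cid => y []. Qed.
Fact munit_mulrV : right_inverse munit_one munit_inv munit_mul.
Proof. by move=> x; apply: val_inj; rewrite /munit_inv /=; case: cid => y []. Qed.
HB.instance Definition _ := isGroup.Build munit
  munit_mulA munit_mul1 munit_mulr1 munit_mulV munit_mulrV.
End MonoidUnits.

Section Endomorphisms.
Variables (k : closedFieldType) (n r : nat).
Variable f : 'I_r -> {malg {poly k}[{fmonom 'I_n}]}.

(* The parameter qhat is treated as a scalar: endomorphisms of Ahat are k-algebra
   endomorphisms fixing qhat.  This cannot be dropped: Ahat is isomorphic to A as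
   a k-algebra, qhat corresponding to t.  For A = k[t], the map t |-> t + 1 does
   not preserve the kernel of Gammahat; for A = k[t]<x, y>/(xy - yx - t), the
   automorphism t |-> 2t, x |-> 2x, y |-> y induces x |-> 2x, y |-> y on
   Abar = k[x, y], which does not preserve {x, y} = 1. *)
Definition Ahat_endo (s : Ahat f -> Ahat f) : Prop :=
  [/\ zmod_morphism s, GRing.monoid_morphism s, scalable s
    & s (Ahat_q f) = Ahat_q f].

Definition poisson_endo (s : Abar f -> Abar f) : Prop :=
  [/\ zmod_morphism s, GRing.monoid_morphism s, scalable s
    & forall u v, s (pbracket u v) = pbracket (s u) (s v)].

Fact Ahat_endo_id : Ahat_endo id. Proof. by []. Qed.
Fact Ahat_endo_comp s u : Ahat_endo s -> Ahat_endo u -> Ahat_endo (s \o u).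
Proof.
move=> [sB [s1 sM] sZ sq] [uB [u1 uM] uZ uq].
split=> [x y||c x|] /=; first by rewrite uB sB.
- by split=> [|x y] /=; rewrite ?u1 ?s1 ?uM ?sM.
- by rewrite uZ sZ.
- by rewrite uq sq.
Qed.

Fact poisson_endo_id : poisson_endo id. Proof. by []. Qed.
Fact poisson_endo_comp s u :
  poisson_endo s -> poisson_endo u -> poisson_endo (s \o u).
Proof.
move=> [sB [s1 sM] sZ sq] [uB [u1 uM] uZ uq].
split=> [x y||c x|x y] /=; first by rewrite uB sB.
- by split=> [|x y] /=; rewrite ?u1 ?s1 ?uM ?sM.
- by rewrite uZ sZ.
- by rewrite uq sq.
Qed.

Definition Ahat_endos := EndoClass Ahat_endo_id Ahat_endo_comp.
Definition EndAhat : Type := endo Ahat_endos.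
HB.instance Definition _ := Monoid.on EndAhat.
Definition AutAhat : Type := munit EndAhat.
HB.instance Definition _ := Group.on AutAhat.

Lemma EndAhat_invertible (s : EndAhat) : invertible s <-> bijective s.
Proof.
split=> [[u [su us]]|[g sg gs]].
  by exists u => x; [have := congr1 (@^~ x \o val) us
                   | have := congr1 (@^~ x \o val) su].
have [sB [s1 sM] sZ sq] := elimT (asboolP _) (endoP s).
have Eg : Ahat_endo g.
  split=> [x y||c x|]; first by rewrite -{1}(gs x) -{1}(gs y) -sB sg.
  - by split=> [|x y]; rewrite -1?{1}s1 ?sg // -{1}(gs x) -{1}(gs y) -sM sg.
  - by rewrite -{1}(gs x) -sZ sg.
  - by rewrite -{1}sq sg.
exists (@Endo _ Ahat_endos g (introT (asboolP _) Eg)).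
by split; apply/val_inj/funext => x /=; rewrite ?gs ?sg.
Qed.

Definition poisson_endos := EndoClass poisson_endo_id poisson_endo_comp.
Definition PEndAbar : Type := endo poisson_endos.
HB.instance Definition _ := Monoid.on PEndAbar.
Definition PAutAbar : Type := munit PEndAbar.
HB.instance Definition _ := Group.on PAutAbar.

Lemma PEndAbar_invertible (s : PEndAbar) : invertible s <-> bijective s.
Proof.
split=> [[u [su us]]|[g sg gs]].
  by exists u => x; [have := congr1 (@^~ x \o val) us
                   | have := congr1 (@^~ x \o val) su].
have [sB [s1 sM] sZ sq] := elimT (asboolP _) (endoP s).
have Eg : poisson_endo g.
  split=> [x y||c x|x y]; first by rewrite -{1}(gs x) -{1}(gs y) -sB sg.
  - by split=> [|x y]; rewrite -1?{1}s1 ?sg // -{1}(gs x) -{1}(gs y) -sM sg.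
  - by rewrite -{1}(gs x) -sZ sg.
  - by rewrite -{1}(gs x) -{1}(gs y) -sq sg.
exists (@Endo _ poisson_endos g (introT (asboolP _) Eg)).
by split; apply/val_inj/funext => x /=; rewrite ?gs ?sg.
Qed.
End Endomorphisms.

Definition is_basis (K : pzRingType) (V : lmodType K) (I : choiceType)
    (xi : I -> V) : Prop :=
  (forall v, exists (s : seq I) (c : I -> K), v = \sum_(i <- s) c i *: xi i) /\
  (forall (s : seq I) (c : I -> K), uniq s -> \sum_(i <- s) c i *: xi i = 0 ->
     forall i, i \in s -> c i = 0).

(* Main.v *)
(** Writing an element of A_qhat over a common denominator qhat^m shows that
    A_qhat is A with t inverted.  Since a polynomial vanishing on k^* is zero, the
    bases xi make both gamma and the evaluation map A_qhat -> prod_q A_q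
    injective.  Hence A -> Ahat, a(t) |-> a(qhat), is an isomorphism taking t to
    qhat and Gammahat to the projection A -> A/tA, so an endomorphism of Ahat
    fixing qhat is a k[t]-endomorphism of A: it preserves tA, and applying it to
    t c = [a, b] gives the Poisson property of the induced map. *)
From HB Require Import structures.
Require Import Defs.
From mathcomp Require Import finmap monalg.
From mathcomp Require Import all_boot all_algebra.
From mathcomp Require Import boolp classical_sets functions.

Set Implicit Arguments.
Unset Strict Implicit.
Unset Printing Implicit Defensive.

Import GRing.Theory.
Local Open Scope ring_scope.

(** If [p] were nonzero, [p * 'X + 1] would be nonconstant and so have a root, which could be
    neither 0 nor a root of [p]. *)
Lemma poly_eq0_on_units (k : closedFieldType) (p : {poly k}) :
  (forall q : k, q != 0 -> p.[q] = 0) -> p = 0.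
Proof.
move=> p0; apply/eqP/negPn/negP => pn0.
have sz : size (p * 'X + 1%:P) != 1%N.
  rewrite size_polyDl size_mulX // ?size_poly1 ?ltnS ?eqSS -?lt0n;
    by rewrite size_poly_gt0.
have [x] := closed_rootP _ sz.
rewrite rootE !hornerE; have [->|/p0 ->] := eqVneq x 0.
  by rewrite mulr0 add0r oner_eq0.
by rewrite mul0r add0r oner_eq0.
Qed.

(** Spanning allows repeated indices, while independence is stated for [uniq] lists only;
    repetitions are merged with multiplicity. *)
Lemma is_basis_uniq (K : pzRingType) (V : lmodType K) (I : choiceType)
    (xi : I -> V) : is_basis xi ->
  forall v, exists (s : seq I) (c : I -> K),
    uniq s /\ v = \sum_(i <- s) c i *: xi i.
Proof.
move=> [sp _] v; have [s [c ->]] := sp v.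
exists (undup s), (fun i => c i *+ count_mem i s); split; first exact: undup_uniq.
rewrite -big_undup_iterop_count; apply: eq_bigr => i _.
by rewrite -scalerMnl.
Qed.

(** * The substitution of qhat for t, from A to A_qhat *)

Section ClassicalLimit.
Variables (k : closedFieldType) (n r : nat).
Variable f : 'I_r -> {malg {poly k}[{fmonom 'I_n}]}.

Local Notation qA := (qA f).
Local Notation qAhat := (qAhat f).

Lemma free_to_hat_rel s : range f s ->
  (@proj _ (range (qAhat_rel f)) \o Defs.coef_map (@poly_qhat k)) s = 0.
Proof.
case=> i _ <- /=; rewrite -[RHS](rmorph0 (@proj _ (range (qAhat_rel f)))).
by apply/projP; rewrite subr0; apply: sub_ideal_gen; exists i.
Qed.

Definition to_hat : qA -> qAhat := quot_lift free_to_hat_rel.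
HB.instance Definition _ := GRing.RMorphism.on to_hat.

Lemma eval_atB (q : kstar k) (x y : qAhat) :
  eval_at q (x - y) = eval_at q x - eval_at q y.
Proof. exact: rmorphB. Qed.
Lemma eval_atM (q : kstar k) (x y : qAhat) :
  eval_at q (x * y) = eval_at q x * eval_at q y.
Proof. exact: rmorphM. Qed.

Lemma eval_to_hat (q : kstar k) (a : qA) :
  eval_at q (to_hat a) = spec (sval q) a.
Proof.
have [g <-] := proj_surj a.
rewrite /to_hat quot_liftE; apply: etrans (quot_liftE (@free_eval_rel _ _ _ f q) _) _.
exact: free_eval_poly_qhat.
Qed.

Lemma to_hat_scalar (p : {poly k}) :
  to_hat (qA_scalar f p) = qAhat_scalar f (poly_qhat p).
Proof.
rewrite /qA_scalar /qAhat_scalar !free_scalar.unlock /to_hat quot_liftE /=.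
by rewrite coef_mapU.
Qed.

Lemma to_hatB a b : to_hat (a - b) = to_hat a - to_hat b.
Proof. exact: rmorphB. Qed.
Lemma to_hatM a b : to_hat (a * b) = to_hat a * to_hat b.
Proof. exact: rmorphM. Qed.
Lemma to_hat1 : to_hat 1 = 1.
Proof. exact: rmorph1. Qed.

Lemma qhat_unit m : exists u : laurent k, u * poly_qhat 'X^m = 1.
Proof.
have uP : (fun q : kstar k => (sval q ^+ m)^-1) \in @laurent_pred k.
  by apply/asboolP; exists 1, m => q; rewrite hornerC div1r.
exists (Laurent uP); apply/val_inj/funext => q /=.
rewrite /GRing.mul /= hornerXn; apply: mulVf; exact: expf_neq0 (svalP q).
Qed.

Lemma clear_denominators (z : qAhat) :
  exists m (a : qA), qAhat_scalar f (poly_qhat 'X^m) * z = to_hat a.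
Proof.
have [g <-] := proj_surj z; rewrite (monalgE g).
apply: (big_ind (fun h => exists m (a : qA),
  qAhat_scalar f (poly_qhat 'X^m) * @proj _ (range (qAhat_rel f)) h = to_hat a)).
- by exists 0%N, 0; rewrite !raddf0 mulr0.
- move=> x y [m [a ha]] [l [b hb]].
  (* Cross-multiplying the numerators puts both terms over qhat^(m+l). *)
  exists (m + l)%N, (qA_scalar f 'X^l * a + qA_scalar f 'X^m * b).
  rewrite raddfD mulrDr; set L := qAhat_scalar f; set P := @poly_qhat k.
  have -> : to_hat (qA_scalar f 'X^l * a + qA_scalar f 'X^m * b) =
      to_hat (qA_scalar f 'X^l * a) + to_hat (qA_scalar f 'X^m * b).
    exact: rmorphD.
  rewrite !to_hatM !to_hat_scalar -ha -hb !mulrA -!(rmorphM L) -!(rmorphM P).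
  by rewrite -!exprD [(l + m)%N]addnC.
(* A Laurent coefficient is p(qhat)/qhat^m; its numerator gives the witness. *)
move=> w _; have /asboolP[p [m pE]] := laurentP (g@_w).
exists m, (free_proj f << p *g w >>).
rewrite /qAhat_scalar free_scalar.unlock /to_hat quot_liftE /= -rmorphM.
rewrite coef_mapU malgUM mul1m; congr (proj _ << _ *g _ >>).
apply/val_inj/funext => q; rewrite /= /GRing.mul /= pE hornerXn mulrC divfK //.
exact: expf_neq0 (svalP q).
Qed.

Lemma hat_to_hat (a : qA) : hat (to_hat a) = gamma a.
Proof. by apply: functional_extensionality_dep => q; exact: eval_to_hat. Qed.

Lemma to_hat_in_Ahat (a : qA) : to_hat a \in @Ahat_pred k n r f.
Proof. by apply/asboolP; exists a; rewrite ?hat_to_hat. Qed.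

Definition to_Ahat (a : qA) : Ahat f := MkAhat (to_hat_in_Ahat a).

Lemma to_AhatB a b : to_Ahat (a - b) = to_Ahat a - to_Ahat b.
Proof. by apply: val_inj; exact: to_hatB. Qed.
Lemma to_AhatM a b : to_Ahat (a * b) = to_Ahat a * to_Ahat b.
Proof. by apply: val_inj; exact: to_hatM. Qed.
Lemma to_Ahat1 : to_Ahat 1 = 1.
Proof. by apply: val_inj; exact: to_hat1. Qed.
Lemma to_Ahat_t : to_Ahat (qA_t f) = Ahat_q f.
Proof. by apply: val_inj; exact: to_hat_scalar. Qed.
Lemma to_AhatZ (c : k) a : to_Ahat (c%:P *: a) = c *: to_Ahat a.
Proof. by apply: val_inj; rewrite /= to_hatM to_hat_scalar. Qed.

Lemma spec_scale (q : k) (p : {poly k}) (a : qA) :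
  spec q (p *: a) = p.[q] *: spec q a.
Proof. by rewrite [LHS]specM spec_scalar. Qed.

Lemma qA_scalar0 : qA_scalar f 0%:P = 0.
Proof. by rewrite polyC0; exact: rmorph0. Qed.

Lemma bar_t_mul (c : qA) : bar (qA_t f * c) = 0.
Proof.
rewrite [LHS]specM [X in X * _]spec_scalar hornerX.
by rewrite qA_scalar0 spec0 mul0r.
Qed.

(** * The isomorphism between A and Ahat *)

Section Basis.
Variables (I : choiceType) (xi : I -> qA).
Hypothesis xi_basis : is_basis xi.
Hypothesis xi_basis_q : forall q : k, q != 0 -> is_basis (fun i => spec q (xi i)).

(** The coordinates of the image of [a] in A_q are the values at q of its polynomial coordinates,
    which therefore vanish on k^*. *)
Lemma gamma_eq0 (a : qA) : (forall q : kstar k, spec (sval q) a = 0) -> a = 0.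
Proof.
have [s [c [s_uniq ->]]] := is_basis_uniq xi_basis a => a0.
rewrite big_seq big1 // => i si; suff -> : c i = 0 by rewrite scale0r.
apply: poly_eq0_on_units => q q0.
have [_ /(_ s (fun i => (c i).[q]) s_uniq)] := xi_basis_q q0.
apply=> //; rewrite -[RHS](a0 (exist _ q q0)) /= [RHS]raddf_sum.
by apply: eq_bigr => l _; rewrite [RHS]spec_scale.
Qed.

(** A power of qhat times [z] comes from A, where [gamma_eq0] applies, and that power is a unit. *)
Lemma hat_eq0 (z : qAhat) : (forall q : kstar k, eval_at q z = 0) -> z = 0.
Proof.
move=> z0; have [m [a za]] := clear_denominators z; have [u uX] := qhat_unit m.
have a0 : a = 0.
  by apply: gamma_eq0 => q; rewrite -eval_to_hat -za eval_atM z0 mulr0.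
move: (congr1 (fun y => qAhat_scalar f u * y) za).
rewrite mulrA -(rmorphM (qAhat_scalar f)) uX (rmorph1 (qAhat_scalar f)) mul1r.
by rewrite a0 (rmorph0 to_hat) mulr0.
Qed.

(** Membership in Ahat supplies an [a] with the same value as [z] at every q, and by [hat_eq0] these
    values determine [z]. *)
Lemma to_Ahat_surj (z : Ahat f) : exists a, to_Ahat a = z.
Proof.
have /asboolP[a _ az] := AhatP z; exists a; apply: val_inj => /=.
apply/eqP; rewrite -subr_eq0; apply/eqP; apply: hat_eq0 => q.
rewrite eval_atB [X in X - _]eval_to_hat; apply/eqP; rewrite subr_eq0; apply/eqP.
exact: (congr1 (@^~ q) az).
Qed.

Lemma gamma_inj (a b : qA) : gamma a = gamma b -> a = b.
Proof.
move=> ab; apply/eqP; rewrite -subr_eq0; apply/eqP; apply: gamma_eq0 => q.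
rewrite specB; apply/eqP; rewrite subr_eq0; apply/eqP.
exact: (congr1 (@^~ q) ab).
Qed.

Lemma to_Ahat_inj : injective to_Ahat.
Proof.
move=> a b /(congr1 (@Ahat_val _ _ _ f)) /= ab.
by apply: gamma_inj; rewrite -!hat_to_hat ab.
Qed.

Lemma Gammahat_to_Ahat (a : qA) : Gammahat (to_Ahat a) = bar a.
Proof.
rewrite /Gammahat /= hat_to_hat; congr bar; rewrite /gamma_inv.
(* The default 0 of [xget] is not reached: [a] is a preimage, and the only one by [gamma_inj]. *)
by case: xgetP => [b _ /gamma_inj|/(_ a erefl)].
Qed.

Hypothesis treg : t_regular f.

Lemma bar_eq (a b : qA) : bar a = bar b -> exists c, a - b = qA_t f * c.
Proof.
move=> /(specP treg)[c ->]; exists c.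
by rewrite qA_scalar0 subr0.
Qed.

(** * The Poisson endomorphism induced by an endomorphism of Ahat *)

Section Limit.
Variable s : Ahat f -> Ahat f.
Hypothesis Es : Ahat_endo s.

(** [qrepr] picks an arbitrary lift to A; [limitE] shows that the choice is immaterial. *)
Definition limit (u : Abar f) : Abar f := Gammahat (s (to_Ahat (qrepr u))).

(** Two lifts to A differ by some t c; as [s] fixes qhat, their images differ by a multiple of qhat,
    which [Gammahat] kills. *)
Lemma limitE (a : qA) : limit (bar a) = Gammahat (s (to_Ahat a)).
Proof.
have [sB [s1 sM] sZ sq] := Es; rewrite /limit.
have [c] := bar_eq (qreprK (bar a)).
move=> /(congr1 (s \o to_Ahat)) /=; rewrite to_AhatB to_AhatM to_Ahat_t sB sM sq.
have [x <-] := to_Ahat_surj (s (to_Ahat (qrepr (bar a)))).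
have [y <-] := to_Ahat_surj (s (to_Ahat a)).
have [d <-] := to_Ahat_surj (s (to_Ahat c)).
rewrite -to_Ahat_t -to_AhatM -to_AhatB => /to_Ahat_inj xy.
rewrite !Gammahat_to_Ahat; apply/eqP; rewrite -subr_eq0 -[X in X == _]specB xy.
by rewrite [spec _ _]bar_t_mul.
Qed.

Lemma limit_poisson : poisson_endo limit.
Proof.
have [sB [s1 sM] sZ sq] := Es.
have lift u : exists a a',
    [/\ bar a = u, s (to_Ahat a) = to_Ahat a' & limit u = bar a'].
  have [a <-] := proj_surj u; have [a' a'E] := to_Ahat_surj (s (to_Ahat a)).
  by exists a, a'; split=> //; rewrite [limit _]limitE -a'E Gammahat_to_Ahat.
split=> [u v||c u|u v].
- have [a [a' [<- sa ->]]] := lift u; have [b [b' [<- sb ->]]] := lift v.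
  rewrite -[bar a - _]specB [limit _]limitE to_AhatB sB sa sb.
  by rewrite -to_AhatB Gammahat_to_Ahat [LHS]specB.
- split=> [|u v].
    by rewrite -(spec1 f 0) [LHS]limitE to_Ahat1 s1 -to_Ahat1 Gammahat_to_Ahat.
  have [a [a' [<- sa ->]]] := lift u; have [b [b' [<- sb ->]]] := lift v.
  rewrite -[bar a * _]specM [limit _]limitE to_AhatM sM sa sb.
  by rewrite -to_AhatM Gammahat_to_Ahat [LHS]specM.
- have [a [a' [<- sa ->]]] := lift u.
  have barZ (x : qA) : c *: bar x = bar (c%:P *: x).
    by have := spec_scale 0 c%:P x; rewrite hornerC => /esym.
  by rewrite !barZ limitE to_AhatZ sZ sa -to_AhatZ Gammahat_to_Ahat.
have [a [a' [<- sa ->]]] := lift u; have [b [b' [<- sb ->]]] := lift v.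
(* Commutativity of Abar makes ab - ba divisible by t. *)
have [|c tc] := @bar_eq (a * b) (b * a).
  by rewrite [LHS]specM [RHS]specM (Abar_comm treg).
rewrite (pbracketE treg (esym tc)) limitE.
have [c' c'E] := to_Ahat_surj (s (to_Ahat c)).
(* It remains to see t c' = a'b' - b'a', which is [s] applied to t c = ab - ba, read back in A. *)
rewrite -c'E Gammahat_to_Ahat; symmetry; apply: (pbracketE treg).
apply: to_Ahat_inj; rewrite to_AhatM to_Ahat_t c'E -sq -sM -to_Ahat_t -to_AhatM -tc.
by rewrite !to_AhatB !to_AhatM sB !sM sa sb.
Qed.

(** Every element of Ahat comes from A, so any lift of [z] to Ahat computes the same value. *)
Lemma limitP (z w : Abar f) :
  limit z = w <-> exists2 z' : Ahat f, Gammahat z' = z & Gammahat (s z') = w.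
Proof.
split=> [<-|[z' <- <-]].
  exists (to_Ahat (qrepr z)) => //; rewrite Gammahat_to_Ahat; exact: qreprK.
by have [a <-] := to_Ahat_surj z'; rewrite Gammahat_to_Ahat limitE.
Qed.
End Limit.

Definition limit_endo (s : EndAhat f) : PEndAbar f :=
  @Endo _ (poisson_endos f) (limit s)
    (introT (asboolP _) (limit_poisson (elimT (asboolP _) (endoP s)))).

Lemma limit_endoP (s : EndAhat f) (z w : Abar f) : limit_endo s z = w <->
  exists2 z' : Ahat f, Gammahat z' = z & Gammahat (s z') = w.
Proof. apply: limitP; exact: (elimT (asboolP _) (endoP s)). Qed.

Local Open Scope group_scope.

Lemma limit_endoM : {morph limit_endo : s u / s * u}.
Proof.
move=> s u; apply/val_inj/funext => z; apply/limit_endoP.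
have /limit_endoP[z' zE uz] : limit_endo u z = limit_endo u z by [].
(* If [z'] lifts [z], then [u z'] lifts [limit_endo u z]. *)
by exists z' => //; symmetry; apply/limit_endoP; exists (u z').
Qed.

Lemma limit_endo1 : limit_endo 1 = 1.
Proof.
apply/val_inj/funext => z; apply/limit_endoP.
by exists (to_Ahat (qrepr z)); rewrite Gammahat_to_Ahat; exact: qreprK.
Qed.

HB.instance Definition _ :=
  isMultiplicative.Build (EndAhat f) (PEndAbar f) limit_endo limit_endoM.
End Basis.
End ClassicalLimit.

(** * Restriction to invertible elements *)

Section MunitMap.
Local Open Scope group_scope.
Variables (M N : monoidType) (h : {multiplicative M -> N}).
Hypothesis h1 : h 1 = 1.

(** A [{multiplicative M -> N}] map need only preserve products; [h1] is what carries inverses to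
    inverses. *)
Lemma invertible_map (x : munit M) : `[< invertible (h (munit_val x)) >].
Proof.
have /asboolP[y [xy yx]] := munitP x.
by apply/asboolP; exists (h y); rewrite -!gmulfM xy yx h1.
Qed.

Definition munit_map (x : munit M) : munit N := Munit (invertible_map x).

Lemma munit_mapM : {morph munit_map : x y / x * y}.
Proof. by move=> x y; apply: val_inj; exact: gmulfM. Qed.

HB.instance Definition _ :=
  isMultiplicative.Build (munit M) (munit N) munit_map munit_mapM.
End MunitMap.

Theorem theorem2p7 (k : closedFieldType) (k_char0 : [pchar k] =i pred0)
    (n r : nat) (f : 'I_r -> {malg {poly k}[{fmonom 'I_n}]})
    (t_reg : t_regular f)
    (Aq_nonzero : forall q : k, q != 0 -> exists a : qAat f q, a <> 0)
    (I : choiceType) (xi : I -> qA f)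
    (xi_basis : is_basis xi)
    (xi_basis_bar : is_basis (fun i => bar (xi i)))
    (xi_basis_q : forall q : k, q != 0 -> is_basis (fun i => spec q (xi i))) :
  exists phi : {multiplicative EndAhat f -> PEndAbar f},
    (forall (s : EndAhat f) (z w : Abar f),
       phi s z = w <-> exists2 z' : Ahat f, Gammahat z' = z & Gammahat (s z') = w)
    /\
    (exists psi : {multiplicative AutAhat f -> PAutAbar f},
       forall s : AutAhat f, munit_val (psi s) = phi (munit_val s)).
Proof.
exists (limit_endo xi_basis xi_basis_q t_reg); split.
  exact: limit_endoP.
(* Automorphisms are the invertible elements of the endomorphism monoids, so [psi] is [phi]
   restricted to them. *)
by exists (munit_map (limit_endo1 xi_basis xi_basis_q t_reg)).
Qed.
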